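(* There is a function $g(k)=O(\log k)$ such that for every $k$, the generalized Work Function Algorithm $\mathrm{WFA}_{1/2}$ is $2^{2^{k+g(k)}}$-competitive for the weighted $k$-server problem on uniform metrics (for every number of points and every choice of weights).
   Context: Weighted $k$-server on a uniform metric: a finite set $U$ of points with $d(p,q)=1$ for $p\ne q$; $k$ servers $s_1,\dots,s_k$ with positive weights $w_1\le\dots\le w_k$; moving $s_i$ to a different point costs $w_i$. Requests $\sigma_1,\dots,\sigma_T\in U$ arrive online and at time $t$ some server must be at $\sigma_t$; the goal is to minimize total movement cost. A configuration is a map $C:\{1,\dots,k\}\to U$ ($C(i)$ is the position of $s_i$), and $d(C,C')=\sum_{i=1}^k w_i\mathbf 1_{C(i)\ne C'(i)}$. Given an initial configuration $C_0$, the work function $\mathrm{WF}_t(C)$ is the minimum cost of serving $\sigma_1,\dots,\sigma_t$ starting from $C_0$ and ending in configuration $C$. The generalized Work Function Algorithm $\mathrm{WFA}_\lambda$ ($\lambda\in(0,1]$), being in configuration $C_{t-1}$, moves upon request $\sigma_t$ to a configuration $C_t\in\arg\min_C \big(\mathrm{WF}_t(C)+\lambda\, d(C,C_{t-1})\big)$. An online algorithm is $\rho$-competitive if there is a constant $\alpha$ independent of the request sequence such that its cost is at most $\rho\cdot\mathrm{OPT}+\alpha$ on every request sequence, where $\mathrm{OPT}$ is the optimal offline cost from the same initial configuration. *)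

(* Defs.v *)
From mathcomp Require Import all_boot all_order all_algebra.
From mathcomp Require Import all_classical all_reals all_analysis.

Set Implicit Arguments.
Unset Strict Implicit.
Unset Printing Implicit Defensive.

Import Order.TTheory GRing.Theory Num.Theory.
Import numFieldNormedType.Exports.

Local Open Scope classical_set_scope.
Local Open Scope ring_scope.

Definition config (k : nat) (U : finType) : Type := {ffun 'I_k -> U}.

Definition config_dist (R : realType) (k : nat) (U : finType) (w : 'I_k -> R)
    (C C' : config k U) : R :=
  \sum_(i < k | C i != C' i) w i.

Definition serves (k : nat) (U : finType) (r : U) (C : config k U) : bool :=
  [exists i : 'I_k, C i == r].

Fixpoint movement_cost (R : realType) (k : nat) (U : finType) (w : 'I_k -> R)
    (C : config k U) (X : seq (config k U)) : R :=
  if X is C' :: X' then config_dist w C C' + movement_cost w C' X' else 0.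

(* [all2] also forces the schedule to have exactly one configuration per
   request. *)
Definition feasible (k : nat) (U : finType) (s : seq U)
    (X : seq (config k U)) : bool :=
  all2 (fun r C => serves r C) s X.

(* The [inf] below are minima for k > 0: feasible schedules for s are then
   finite in number and at least one exists. The final configuration C of the
   work function need not serve the last request: after the last request is
   served, one may still move, at a cost, to C. *)
Definition work_function (R : realType) (k : nat) (U : finType)
    (w : 'I_k -> R) (C0 : config k U) (s : seq U) (C : config k U) : R :=
  inf [set movement_cost w C0 (rcons X C) | X in [set X | feasible s X]].

Definition opt_cost (R : realType) (k : nat) (U : finType)
    (w : 'I_k -> R) (C0 : config k U) (s : seq U) : R :=
  inf [set movement_cost w C0 X | X in [set X | feasible s X]].

(* An algorithm maps the requests received so far to its current
   configuration, hence is online by construction. *)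
Definition algorithm (k : nat) (U : finType) : Type := seq U -> config k U.

Definition online_algorithm (k : nat) (U : finType) (C0 : config k U)
    (A : algorithm k U) : Prop :=
  A [::] = C0 /\ forall (s : seq U) (r : U), serves r (A (rcons s r)).

Definition algorithm_cost (R : realType) (k : nat) (U : finType)
    (w : 'I_k -> R) (A : algorithm k U) (s : seq U) : R :=
  movement_cost w (A [::]) [seq A (take t s) | t <- iota 1 (size s)].

Definition competitive (R : realType) (k : nat) (U : finType)
    (w : 'I_k -> R) (C0 : config k U) (A : algorithm k U) (rho : R) : Prop :=
  online_algorithm C0 A /\
  exists alpha : R, forall s : seq U,
    algorithm_cost w A s <= rho * opt_cost w C0 s + alpha.

(* A is an instance of WFA_lambda, with an arbitrary rule for breaking ties in
   the argmin (the rule may depend on the whole history). *)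
Definition is_WFA (R : realType) (k : nat) (U : finType) (w : 'I_k -> R)
    (lambda : R) (C0 : config k U) (A : algorithm k U) : Prop :=
  A [::] = C0 /\
  forall (s : seq U) (r : U) (C : config k U),
    work_function w C0 (rcons s r) (A (rcons s r))
      + lambda * config_dist w (A (rcons s r)) (A s)
    <= work_function w C0 (rcons s r) C + lambda * config_dist w C (A s).

(* Main.v *)
Require Import Defs.
From mathcomp Require Import all_boot all_order all_algebra.
From mathcomp Require Import all_classical all_reals all_analysis.
From mathcomp Require Import ring lra zify.
Import Order.TTheory GRing.Theory Num.Theory.
Import numFieldNormedType.Exports.
Local Open Scope classical_set_scope.
Local Open Scope ring_scope.

Set Implicit Arguments.
Unset Strict Implicit.
Unset Printing Implicit Defensive.

(** Write [V t C] for the work function. Call [(C, x, y)] an event of size [D]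
    when [V x C + D <= V y X + d X C / 2] for every [X]. The algorithm pays at
    most a constant times [w_1] for each of its events of size [w_1 / 8], so it
    suffices to bound the number of time-disjoint events of that size while
    the minimum of [V] grows by [O(w_k)].

    Events are counted scale by scale. Take events of size [D] with servers
    [i < j] light, i.e. [8 k w_i <= D], and follow the optimal path of each of
    them back to a common time [T]. A path of cost [g] turns the event into one
    of size [D + g / 2] starting at [T], so paths of cost at least [w_j] are
    charged to the scale [D + w_j / 2]. Along cheaper paths the servers [i >= j]
    stand still. Among too many such events one finds an earliest one and a
    family of later ones whose heavy positions are, server by server, either
    constant or pairwise distinct. Every request is then served by a constant
    heavy server or, in almost all members of the family, by a light one, and
    a consensus of the light servers serves the earliest event for less than
    [D], which is absurd. Each server costs one square root in this selection,
    whence [(k + 2) ^ (2 ^ k)]; there are only [16 k^2] scales, because [16 k]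
    steps of [w_j / 2] make server [j] light. *)

(** * Distances between configurations, over all servers and over the light ones *)

Section Distance.
Context {R : realType} {k : nat} {U : finType}.
Variable w : 'I_k -> R.
Hypothesis w_gt0 : forall i, 0 < w i.
Local Notation d := (@config_dist R k U w).
Implicit Types C X Y : config k U.

Definition light_dist (j : nat) C C' : R :=
  \sum_(i < k | (i < j)%N && (C i != C' i)) w i.

Lemma config_distC C X : d C X = d X C.
Proof. by apply: eq_bigl => i; rewrite eq_sym. Qed.

Lemma config_dist_ge0 C X : 0 <= d C X.
Proof. by apply: sumr_ge0 => i _; apply: ltW. Qed.

Lemma config_distxx C : d C C = 0.
Proof. by rewrite /config_dist big1 // => i; rewrite eqxx. Qed.

Lemma config_dist_triangle Y C X : d C X <= d C Y + d Y X.
Proof.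
rewrite /config_dist big_mkcond /= [X in _ <= X + _]big_mkcond /=.
rewrite [X in _ <= _ + X]big_mkcond /= -big_split /=.
apply: ler_sum => i _; have := w_gt0 i.
have [->|_] := eqVneq (C i) (Y i) => /=; first by lra.
by case: ifP; case: ifP => _ _; lra.
Qed.

Lemma weight_le_config_dist C X i : C i != X i -> w i <= d C X.
Proof.
move=> CXi; rewrite /config_dist (bigD1 i) //= lerDl.
by apply: sumr_ge0 => l _; apply: ltW.
Qed.

Lemma config_dist_le0 C X : d C X <= 0 -> C = X.
Proof.
move=> d0; apply/ffunP => i; apply/eqP/negPn/negP => /weight_le_config_dist.
by have := w_gt0 i; lra.
Qed.

Lemma light_dist_ge0 j C X : 0 <= light_dist j C X.
Proof. by apply: sumr_ge0 => i _; apply: ltW. Qed.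

Lemma light_dist_le j C X : light_dist j C X <= d C X.
Proof.
rewrite /light_dist /config_dist big_mkcond [leRHS]big_mkcond /=.
apply: ler_sum => i _; have := w_gt0 i.
by case: (i < j)%N; case: (C i != X i) => /=; lra.
Qed.

End Distance.

(** * Selecting regular subfamilies of finite sequences *)

Section Selection.

(** Scan from the end: keep the last element and discard the at most [b] earlier ones that are bad
    for it. Each kept element uses up at most [b.+1] elements of [s]. *)
Lemma greedy_independent (T : eqType) (bad : rel T) (b : nat) (s : seq T) :
  (forall x, x \in s -> count (bad x) s <= b)%N ->
  exists t, [/\ subseq t s, (size s <= b.+1 * size t)%N
             & pairwise (fun x y => ~~ bad y x) t].
Proof.
have [n] := ubnP (size s); elim: n s => // n IHn s.
case/lastP: s => [|s x]; first by exists [::].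
rewrite size_rcons ltnS => sz_s bad_s.
pose s' := [seq y <- s | ~~ bad x y].
have sub_s' : subseq s' s by apply: filter_subseq.
have sz_s' : (size s <= b + size s')%N.
  rewrite -(count_predC (bad x) s) size_filter leq_add2r.
  have := bad_s x; rewrite mem_rcons mem_head -cats1 count_cat => /(_ isT).
  exact/leq_trans/leq_addr.
have [||t [ts' szt pt]] := IHn s'.
- exact: leq_ltn_trans (size_subseq sub_s') sz_s.
- move=> y /(mem_subseq sub_s') ys.
  have := bad_s y; rewrite mem_rcons inE ys orbT => /(_ isT).
  apply: leq_trans; rewrite -cats1 count_cat.
  by apply: leq_trans (leq_addr _ _); apply: leq_count_subseq.
exists (rcons t x); split.
- by rewrite -!cats1 cat_subseq //; apply: subseq_trans ts' sub_s'.
- by rewrite !size_rcons mulnS; lia.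
rewrite pairwise_rcons pt andbT; apply/allP => y /(mem_subseq ts').
by rewrite mem_filter => /andP[].
Qed.

(** Either some value is frequent enough to be kept alone, or all values are rare and the greedy
    selection, with equality of values as conflict, leaves distinct ones. *)
Lemma constant_or_distinct (T U : eqType) (f : T -> U) (n : nat) (s : seq T) :
  (n ^ 2 <= size s)%N ->
  exists t, [/\ subseq t s, (n <= size t)%N &
    (exists u, forall x, x \in t -> f x = u) \/
    (forall u, (count (fun x => f x == u) t <= 1)%N)].
Proof.
case: n => [_|n sz_s].
  by exists [::]; split; [apply: sub0seq | | right].
have [/hasP[x xs many]|/hasPn few] :=
    boolP (has (fun x => n < count (fun y => f y == f x) s)%N s).
  exists [seq y <- s | f y == f x]; split; first exact: filter_subseq.
    by rewrite size_filter.
  by left; exists (f x) => y; rewrite mem_filter => /andP[/eqP].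
have [|t [ts szt pt]] := greedy_independent (bad := fun x y => f y == f x) (b := n) (s := s).
  by move=> x /few; rewrite -leqNgt.
exists t; split => //.
  by rewrite -(leq_pmul2l (ltn0Sn n)) (leq_trans _ szt) // -expnS.
right=> u; elim: t pt {ts szt} => //= x t IHt /andP[xt /IHt].
case: (eqVneq (f x) u) => [fxu _|//]; rewrite -[(1 + _)%N]/(_.+1) ltnS leqn0.
rewrite eqn0Ngt -has_count; apply/hasPn => y /(allP xt).
by rewrite fxu eq_sym.
Qed.

(* Sunflower-type selection: one square root of the size is lost per
   coordinate, hence the doubly exponential bound. *)
Lemma constant_or_distinct_seq (T I U : eqType) (f : I -> T -> U)
    (cs : seq I) (n : nat) (s : seq T) :
  (n ^ (2 ^ size cs) <= size s)%N ->
  exists t, [/\ subseq t s, (n <= size t)%N & forall i, i \in cs ->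
    (exists u, forall x, x \in t -> f i x = u) \/
    (forall u, (count (fun x => f i x == u) t <= 1)%N)].
Proof.
elim: cs s => [|i cs IHcs] s /=; first by exists s; split => //; rewrite -(expn1 n).
rewrite expnS mulnC expnM => /(constant_or_distinct (f i))[s1 [s1s sz1 fi]].
have [t [ts1 szt ft]] := IHcs s1 sz1.
exists t; split => //; first exact: subseq_trans s1s.
move=> l; rewrite inE => /orP[/eqP->|/ft//].
case: fi => [[u fu]|fu]; [left|right].
  by exists u => x /(mem_subseq ts1)/fu.
by move=> u; apply: leq_trans (fu u); apply: leq_count_subseq.
Qed.

End Selection.

Lemma ler_sum_subseq (R : numDomainType) (I : eqType) (s t : seq I)
    (F : I -> R) :
  (forall i, 0 <= F i) -> subseq t s -> \sum_(i <- t) F i <= \sum_(i <- s) F i.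
Proof.
move=> F_ge0; elim: s t => [|y s IHs] [|x t] //= sub.
  by rewrite big_nil; apply: sumr_ge0.
rewrite [leRHS]big_cons; case: eqP sub => [->|_] sub.
  by rewrite big_cons lerD2l IHs.
by rewrite (le_trans (IHs _ sub)) // lerDr.
Qed.

(** [G] sees only the sequence and the list of values on it. Two functions with equal values thus
    get the same selection, which keeps the consensus below stable while the values do not
    change. *)
Lemma constant_or_distinct_choice (I : eqType) (U : finType) (u0 : U)
    (n : nat) : exists G : seq I * seq U -> U * seq I, forall p,
  subseq (G p).2 p.1 /\
  forall g : I -> U, [seq g x | x <- p.1] = p.2 -> (n ^ 2 <= size p.1)%N ->
    (n <= size (G p).2)%N /\
    ((forall x, x \in (G p).2 -> g x = (G p).1) \/
     (forall u, (count (fun x => g x == u) (G p).2 <= 1)%N)).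
Proof.
suff /choice[G GP] : forall p : seq I * seq U, exists q : U * seq I,
    subseq q.2 p.1 /\
    forall g : I -> U, [seq g x | x <- p.1] = p.2 -> (n ^ 2 <= size p.1)%N ->
      (n <= size q.2)%N /\ ((forall x, x \in q.2 -> g x = q.1) \/
       (forall u, (count (fun x => g x == u) q.2 <= 1)%N)) by exists G.
case=> s vals /=.
have [[g0 vals_g0]|no_g] :=
    pselect (exists g : I -> U, [seq g x | x <- s] = vals); last first.
  by exists (u0, [::]); split=> [|g sg]; [apply: sub0seq|case: no_g; exists g].
have [big|small] := boolP (n ^ 2 <= size s)%N; last first.
  by exists (u0, [::]); split=> [|g _ big]; [apply: sub0seq|case/negP: small].
have [t [ts szt cod]] := constant_or_distinct g0 big.
have g_g0 g : [seq g x | x <- s] = vals -> {in t, g =1 g0}.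
  by rewrite -vals_g0 => /eq_in_map gg0 x /(mem_subseq ts) /gg0.
case: cod => [[u gu]|distinct].
  exists (u, t); split=> //= g /g_g0 gg0 _; split=> //.
  by left=> x xt; rewrite gg0 ?gu.
exists (u0, t); split=> //= g /g_g0 gg0 _; split=> //.
right=> u; rewrite (eq_in_count (a2 := fun x => g0 x == u)) //.
by move=> x xt /=; rewrite gg0.
Qed.

(** * Consensus of the light servers *)

Section Consensus.
Context {R : realType} {k : nat} {U : finType}.
Variable w : 'I_k -> R.
Hypothesis w_gt0 : forall i, 0 < w i.
Hypothesis w_mono : forall i j : 'I_k, (i <= j)%N -> w i <= w j.
Local Notation ld := (@light_dist R k U w).

Definition light_serves (j : nat) (r : U) (C : config k U) : bool :=
  [exists i : 'I_k, (i < j)%N && (C i == r)].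

Lemma light_servesS (j : nat) (lt_jk : (j < k)%N) r C :
  light_serves j.+1 r C = (C (Ordinal lt_jk) == r) || light_serves j r C.
Proof.
apply/existsP/orP => [[i]|].
  rewrite ltnS leq_eqVlt => /andP[/orP[/eqP ij|ij] Ci].
    by left; move: Ci; congr (C _ == r); apply: val_inj.
  by right; apply/existsP; exists i; rewrite ij.
case=> [Cj|/existsP[i /andP[ij Ci]]]; first by exists (Ordinal lt_jk); rewrite /= leqnn.
by exists i; rewrite ltnS ltnW.
Qed.

Lemma light_distS (j : nat) (lt_jk : (j < k)%N) (C X : config k U) :
  ld j.+1 C X = (if C (Ordinal lt_jk) != X (Ordinal lt_jk) then w (Ordinal lt_jk)
                 else 0) + ld j C X.
Proof.
rewrite /light_dist big_mkcond /= (bigD1 (Ordinal lt_jk)) //= leqnn /=.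
congr (_ + _); rewrite [RHS]big_mkcond /= [RHS](bigD1 (Ordinal lt_jk)) //=.
rewrite ltnn /= add0r; apply: eq_bigr => i ij.
by rewrite ltnS leq_eqVlt -val_eqE /= in ij *; rewrite (negPf ij).
Qed.

Lemma light_dist_le_weight (j : nat) (x : R) (C X : config k U) :
  (forall i : 'I_k, (i < j)%N -> w i <= x) -> 0 <= x -> ld j C X <= k%:R * x.
Proof.
move=> wx x_ge0; rewrite /light_dist big_mkcond /=.
apply: (@le_trans _ _ (\sum_(i < k) x)).
  by apply: ler_sum => i _; case: ifP => // /andP[/wx].
by rewrite sumr_const card_ord mulr_natl.
Qed.

(* Server [j] keeps its value as long as no member of the family moves it; if
   some member does, the cost [w j] pays for relocating all servers up to [j],
   since these are no heavier. *)
Lemma light_consensus (I : eqType) (C0 : config k U) (j a : nat) : (j <= k)%N ->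
  exists F : seq I -> (I -> config k U) -> config k U,
    (forall s v r, ((a + j).+1 ^ (2 ^ j) <= size s)%N ->
       (count (fun x => ~~ light_serves j r (v x)) s <= a)%N ->
       light_serves j r (F s v)) /\
    (forall s v v', ld j (F s v) (F s v') <=
       k%:R * \sum_(x <- s) ld j (v x) (v' x)).
Proof.
elim: j a => [|j IHj] a lt_jk.
  (* Without light servers every member misses [r], and the family has more than [a] members, so the
     premise fails. *)
  exists (fun _ _ => C0); split=> [s v r|s v v'].
    rewrite addn0 expn1 => sz_s; rewrite (eq_count (a2 := predT)).
      by rewrite count_predT leqNgt sz_s.
    by move=> x /=; apply/negP => /existsP[].
  rewrite [leLHS]/light_dist big_pred0 //; apply: mulr_ge0 => //.
  by apply: sumr_ge0 => x _; apply: light_dist_ge0.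
(* If server [j] takes distinct values, it is at [r] in at most one selected member, so the servers
   below [j] miss at most one member more. *)
have [F [F_serves F_dist]] := IHj a.+1 (ltnW lt_jk).
set top := Ordinal lt_jk; set n := ((a.+1 + j).+1 ^ (2 ^ j))%N in F_serves.
have [G GP] := constant_or_distinct_choice I (C0 top) n.
pose sel (s : seq I) (v : I -> config k U) := G (s, [seq v x top | x <- s]).
exists (fun s v => [ffun i => if i == top then (sel s v).1
                              else F (sel s v).2 v i]); split.
  move=> s v r sz_s miss.
  have [sub /(_ (fun x => v x top) erefl)] := GP (s, [seq v x top | x <- s]).
  rewrite -/(sel s v) /= => [[|sz cod]].
    by rewrite -expnM mulnC -expnS addSnnS.
  rewrite light_servesS ffunE eqxx; case: eqP => //= topr.
  have : light_serves j r (F (sel s v).2 v).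
    apply: F_serves => //; case: cod => [cst|distinct].
      apply: leq_trans (leqnSn a); apply: leq_trans miss.
      apply: leq_trans (leq_count_subseq _ sub).
      rewrite -!size_filter (eq_in_filter (a2 := fun x => ~~ light_serves j.+1 r (v x))) //.
      move=> x /cst vx; rewrite light_servesS -/top vx.
      by case: eqP topr => //= ->.
    rewrite -addn1 (leq_trans _ (leq_add miss (distinct r))) //.
    apply: leq_trans (leq_add (leq_count_subseq _ sub) (leqnn _)).
    rewrite -count_predUI; apply: leq_trans (leq_addr _ _).
    apply: sub_count => x /=; rewrite light_servesS -/top negb_or.
    by case: eqP => //= _ ->.
  case/existsP=> i /andP[ij Fi]; apply/existsP; exists i; rewrite ij ffunE.
  by rewrite -val_eqE /= ltn_eqF.
move=> s v v'; have ld_ge0 : forall l C X, 0 <= ld l C X by move=> *; apply: light_dist_ge0.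
have [same|] := boolP (all (fun x => v x top == v' x top) s).
  have sel_eq : sel s v = sel s v'.
    by rewrite /sel; do 2!congr (_ _); apply/eq_in_map => x /(allP same)/eqP.
  rewrite light_distS !ffunE eqxx sel_eq eqxx /= add0r.
  apply: (@le_trans _ _ (k%:R * \sum_(x <- (sel s v').2) ld j (v x) (v' x))).
    apply: le_trans (F_dist _ _ _); rewrite /light_dist.
    rewrite le_eqVlt; apply/orP; left; apply/eqP; apply: eq_bigl => i.
    by case: ltnP => //= ij; rewrite !ffunE -val_eqE /= ltn_eqF.
  rewrite ler_wpM2l ?ler0n //.
  apply: (@le_trans _ _ (\sum_(x <- s) ld j (v x) (v' x))).
    by apply: ler_sum_subseq => //; have [] := GP (s, [seq v' x top | x <- s]).
  by apply: ler_sum => x _; rewrite light_distS lerDr; case: ifP => // _; apply: ltW.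
rewrite -has_predC => /hasP[x xs /= vx].
apply: (@le_trans _ _ (k%:R * w top)).
  by apply: light_dist_le_weight; [move=> i ij; apply: w_mono | apply: ltW].
rewrite ler_wpM2l ?ler0n // (big_rem x) //=.
apply: (@le_trans _ _ (ld j.+1 (v x) (v' x))).
  by rewrite light_distS vx lerDl.
by rewrite lerDl; apply: sumr_ge0.
Qed.

End Consensus.

Lemma ler_sum_nat_sub (R : numDomainType) (a a' b b' : nat) (f : nat -> R) :
  (forall t, 0 <= f t) -> (a <= a')%N -> (b' <= b)%N ->
  \sum_(a' <= t < b') f t <= \sum_(a <= t < b) f t.
Proof.
move=> f_ge0 aa' bb'.
have [ba|ab] := leqP b' a'; first by rewrite big_geq //; apply: sumr_ge0.
rewrite [leRHS](big_cat_nat _ (n := a')) //=; last exact: leq_trans (ltnW ab) bb'.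
rewrite [X in _ <= _ + X](big_cat_nat _ (n := b')) //= ?(ltnW ab) //.
by rewrite addrCA lerDl addr_ge0 //; apply: sumr_ge0.
Qed.

Lemma count_has_le (T I : eqType) (f : I -> pred T) (cs : seq I) (s : seq T) :
  (forall i, i \in cs -> count (f i) s <= 1)%N ->
  (count (fun x => has (f^~ x) cs) s <= size cs)%N.
Proof.
elim: cs => [|i cs IHcs] f1 /=; first by rewrite count_pred0.
apply: leq_trans (leq_add (f1 i (mem_head _ _)) (IHcs _)); last first.
  by move=> l lcs; apply: f1; rewrite inE lcs orbT.
by rewrite -count_predUI leq_addr.
Qed.

Lemma sub_in_count (T : eqType) (a1 a2 : pred T) (s : seq T) :
  {in s, forall x, a1 x -> a2 x} -> (count a1 s <= count a2 s)%N.
Proof.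
elim: s => //= x s IHs a12; apply: leq_add.
  by case: (a1 x) (a12 x (mem_head _ _)) => // ->.
by apply: IHs => y ys; apply: a12; rewrite inE ys orbT.
Qed.

(** * Events of a work function *)

Section Events.
Context {R : realType} {k : nat} {U : finType}.
Variable w : 'I_k -> R.
Hypothesis w_gt0 : forall i, 0 < w i.
Hypothesis w_mono : forall i j : 'I_k, (i <= j)%N -> w i <= w j.
Local Notation d := (@config_dist R k U w).
Local Notation ld := (@light_dist R k U w).
Local Notation ev := (config k U * nat * nat)%type.

(** [V t] stands for the work function after [t] requests, so [sigma t] leads from [V t] to
    [V t.+1]. It enters only through the three properties that follow. *)
Variables (sigma : nat -> U) (V : nat -> config k U -> R).
Hypothesis V0_lip : forall X C, V 0 C <= V 0 X + d X C.
Hypothesis V_step : forall t X C,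
  serves (sigma t) X -> V t.+1 C <= V t X + d X C.
Hypothesis V_opt : forall t C,
  exists2 X, serves (sigma t) X & V t.+1 C = V t X + d X C.

Let d_ge0 C X : 0 <= d C X := config_dist_ge0 w_gt0 C X.
Hint Resolve d_ge0 : core.

Lemma V_lip t X C : V t C <= V t X + d X C.
Proof.
case: t => [|t]; first exact: V0_lip.
have [Y rY ->] := V_opt t X.
by have := V_step C rY; have := config_dist_triangle w_gt0 X Y C; lra.
Qed.

Lemma V_homo x y C : (x <= y)%N -> V x C <= V y C.
Proof.
elim: y => [|y IHy]; first by rewrite leqn0 => /eqP->.
rewrite leq_eqVlt => /orP[/eqP->//|]; rewrite ltnS => /IHy /le_trans; apply.
by have [X _ ->] := V_opt y C; apply: V_lip.
Qed.

Definition path_cost (P : nat -> config k U) (a b : nat) : R :=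
  \sum_(a <= t < b) d (P t) (P t.+1).

Lemma optimal_path T x C : (T <= x)%N -> exists P : nat -> config k U,
  [/\ P x = C, forall t, (T <= t < x)%N -> serves (sigma t) (P t)
    & V x C = V T (P T) + path_cost P T x].
Proof.
elim: x C => [|x IHx] C.
  rewrite leqn0 => /eqP->; exists (fun=> C).
  by split=> //; rewrite /path_cost big_geq ?addr0.
rewrite leq_eqVlt => /orP[/eqP->|].
  exists (fun=> C); split=> //; first by move=> t; lia.
  by rewrite /path_cost big_geq ?addr0.
rewrite ltnS => Tx; have [X rX VX] := V_opt x C; have [P [Px rP VP]] := IHx X Tx.
exists (fun t => if t == x.+1 then C else P t); split; first by rewrite eqxx.
  move=> t /andP[Tt]; rewrite ltnS leq_eqVlt => /orP[/eqP->|tx].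
    by rewrite ltn_eqF // Px.
  by rewrite ltn_eqF ?rP ?Tt // ltnW.
rewrite VX VP /path_cost big_nat_recr //= ltn_eqF ?ltnS // eqxx.
rewrite ltn_eqF // Px addrA; congr (_ + _ + _).
rewrite !big_nat; apply: eq_bigr => t /andP[_ tx].
by rewrite !ltn_eqF // ?ltnS // ltnW.
Qed.

Lemma path_cost_ub (P : nat -> config k U) x y : (x <= y)%N ->
  (forall t, (x <= t < y)%N -> serves (sigma t) (P t)) ->
  V y (P y) <= V x (P x) + path_cost P x y.
Proof.
elim: y => [|y IHy].
  by rewrite leqn0 => /eqP-> _; rewrite /path_cost big_geq ?addr0.
rewrite leq_eqVlt => /orP[/eqP-> _|]; first by rewrite /path_cost big_geq ?addr0.
rewrite ltnS => xy rP; rewrite /path_cost big_nat_recr //= addrA.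
apply: le_trans (V_step _ (rP y _)) _; first by rewrite xy ltnSn.
rewrite lerD2r IHy // => t /andP[xt ty]; apply: rP; rewrite xt /=; exact: ltnW.
Qed.

Lemma config_dist_path (P : nat -> config k U) x y : (x <= y)%N ->
  d (P x) (P y) <= path_cost P x y.
Proof.
elim: y => [|y IHy]; first by rewrite leqn0 => /eqP->; rewrite config_distxx sumr_ge0.
rewrite leq_eqVlt => /orP[/eqP->|]; first by rewrite config_distxx sumr_ge0.
rewrite ltnS => xy; rewrite /path_cost big_nat_recr //=.
apply: le_trans (config_dist_triangle w_gt0 (P y) _ _) _.
by rewrite lerD2r IHy.
Qed.

(** A single move of a server [i >= j] would already cost at least [w j], since weights are
    monotone. *)
Lemma path_static (P : nat -> config k U) (j : 'I_k) T x :
  path_cost P T x < w j ->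
  forall (i : 'I_k) t, (j <= i)%N -> (T <= t <= x)%N -> P t i = P x i.
Proof.
move=> cheap i t ij /andP[Tt]; elim: x cheap => [|x IHx] cheap.
  by rewrite leqn0 => /eqP->.
rewrite leq_eqVlt => /orP[/eqP->//|]; rewrite ltnS => tx.
move: cheap; rewrite /path_cost big_nat_recr /=; last exact: leq_trans tx.
move=> cheap; have c_ge0 : 0 <= path_cost P T x by apply: sumr_ge0.
rewrite IHx //; last by rewrite (le_lt_trans _ cheap) // lerDl.
apply/eqP/negPn/negP => /(weight_le_config_dist w_gt0).
move: cheap c_ge0; rewrite /path_cost; have := w_mono ij; lra.
Qed.

(* An event [(C, x, y)] records that the minimum of [V y X + d X C / 2], the
   objective of the algorithm standing at [C], exceeds [V x C] by [D]. *)
Definition is_event (D : R) (e : ev) : Prop :=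
  forall X, V e.1.2 e.1.1 + D <= V e.2 X + 1 / 2 * d X e.1.1.

Fixpoint event_seq (D : R) (a b : nat) (l : seq ev)
    : Prop :=
  if l is e :: l' then
    [/\ (a <= e.1.2)%N, (e.1.2 <= e.2)%N, is_event D e & event_seq D e.2 b l']
  else (a <= b)%N.

Lemma event_seq_le D a b l : event_seq D a b l -> (a <= b)%N.
Proof.
elim: l a => //= e l IHl a [ae ee _ /IHl]; exact/leq_trans/(leq_trans ae).
Qed.

Lemma event_seq_catl D a b l1 l2 : event_seq D a b (l1 ++ l2) ->
  exists2 c, event_seq D a c l1 & event_seq D c b l2.
Proof.
elim: l1 a => [|e l1 IHl] a /=; first by exists a.
by case=> ae ee De /IHl[c l1c l2c]; exists c.
Qed.

Lemma event_seq_cat D a b c l1 l2 :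
  event_seq D a b l1 -> event_seq D b c l2 -> event_seq D a c (l1 ++ l2).
Proof.
elim: l1 a => [|e l1 IHl] a /=; last by case=> ae ee De l1b l2c; split=> //; apply: IHl.
by case: l2 => [|e l2] ab /=; [apply: leq_trans | case=> be ? ? ?; split=> //; apply: leq_trans be].
Qed.

Lemma event_seq_mem D a b l e : event_seq D a b l -> e \in l ->
  [/\ (a <= e.1.2)%N, (e.1.2 <= e.2)%N, (e.2 <= b)%N & is_event D e].
Proof.
elim: l a => //= e' l IHl a [ae ee De lb]; rewrite inE => /orP[/eqP->|el].
  by split=> //; apply: event_seq_le lb.
by have [? ? ? ?] := IHl _ lb el; split=> //; apply: leq_trans ae (leq_trans ee _).
Qed.

Lemma event_seq_pairwise D a b l : event_seq D a b l ->
  pairwise (fun e e' => e.2 <= e'.1.2)%N l.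
Proof.
elim: l a => //= e l IHl a [_ _ _ lb]; rewrite (IHl _ lb) andbT.
by apply/allP => e' /(event_seq_mem lb)[].
Qed.

Lemma sum_event_seq_le D a b l (f : nat -> R) x : (forall t, 0 <= f t) ->
  event_seq D a b l ->
  \sum_(e <- l | (e.2 <= x)%N) \sum_(e.1.2 <= t < e.2) f t <= \sum_(a <= t < x) f t.
Proof.
move=> f_ge0; elim: l a => [|e l IHl] a /=.
  by rewrite big_nil => _; apply: sumr_ge0.
case=> ae ee _ lb; rewrite big_cons; have := IHl _ lb; case: leqP => [ex|xe].
  move=> IH; rewrite (big_cat_nat _ (n := e.2) (p := x)) //=; last exact: leq_trans ee.
  by apply: lerD => //; apply: ler_sum_nat_sub.
rewrite [X in _ <= X]big_geq ?(ltnW xe) // => /le_trans; apply.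
by apply: sumr_ge0.
Qed.

(** Let [g] be the cost of the path. Writing [V x C] as [V T (P T) + g] gains [g], and bounding
    [d X C] by [d X (P T) + g] gives back only [g / 2]. *)
Lemma event_weight_gain D T e (P : nat -> config k U) (j : 'I_k) :
  (T <= e.1.2)%N -> is_event D e -> P e.1.2 = e.1.1 ->
  V e.1.2 e.1.1 = V T (P T) + path_cost P T e.1.2 ->
  w j <= path_cost P T e.1.2 ->
  is_event (D + w j / 2) (P T, T, e.2).
Proof.
move=> Te De Pe Ve costly X /=; have := De X.
have := config_dist_path P Te; rewrite Pe => dP.
by have := config_dist_triangle w_gt0 (P T) X e.1.1; lra.
Qed.

(** The required length has two factors. The first pays for discarding events until each remaining
    path is almost idle during the earlier remaining events; the second, [P], pays for the selection
    on heavy servers. *)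
Lemma many_events_gain D T b l (j : 'I_k) (P := ((k + 2) ^ (2 ^ k))%N) :
  0 < D -> (forall i : 'I_k, (i < j)%N -> 8 * k%:R * w i <= D) ->
  event_seq D T b l ->
  ((Num.truncn (2 * k%:R * P%:R * w j / D)).+1 * P <= size l)%N ->
  exists2 e, e \in l & exists X, is_event (D + w j / 2) (X, T, e.2).
Proof.
move=> D_gt0 light evl sz_l.
have k_gt0 : (0 < k)%N by apply: leq_ltn_trans (ltn_ord j).
have P_gt0 : (0 < P)%N by rewrite expn_gt0 addn2.
have kR_gt0 : 0 < k%:R :> R by rewrite ltr0n.
have PR_gt0 : 0 < P%:R :> R by rewrite ltr0n.
have /choice[path pathP] : forall e : ev,
    exists p : nat -> config k U, (T <= e.1.2)%N ->
    [/\ p e.1.2 = e.1.1, forall t, (T <= t < e.1.2)%N -> serves (sigma t) (p t)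
      & V e.1.2 e.1.1 = V T (p T) + path_cost p T e.1.2].
  move=> e; have [Te|] := leqP T e.1.2; last by exists (fun=> e.1.1).
  by have [p pP] := optimal_path e.1.1 Te; exists p.
have [/hasP[e el costly]|/hasPn cheap] :=
    boolP (has (fun e => w j <= path_cost (path e) T e.1.2) l).
  have [Te _ _ De] := event_seq_mem evl el; have [pe _ Ve] := pathP e Te.
  by exists e => //; exists (path e T); apply: event_weight_gain Ve costly.
(* With [eps] spent by each of at most [P] paths and the factor [k] of the consensus, the total is
   at most [k * P * eps = D / 2]. *)
exfalso; pose eps := D / (2 * k%:R * P%:R).
have eps_gt0 : 0 < eps by rewrite divr_gt0 ?mulr_gt0.
pose chunk (x y : ev) := path_cost (path x) y.1.2 y.2.
pose bad (x y : ev) := (y.2 <= x.1.2)%N && (eps < chunk x y).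
(* The path of [x] costs less than [w j] in all, and the events before [x] are disjoint in time, so
   at most [w j / eps] of them can each take more than [eps]. *)
have few_bad x : x \in l ->
    (count (bad x) l <= Num.truncn (2 * k%:R * P%:R * w j / D))%N.
  move=> xl; have := cheap x xl; rewrite -ltNge => cost_x.
  rewrite truncn_ge_nat; last by rewrite !mulr_ge0 ?invr_ge0 ?ltW.
  have -> : 2 * k%:R * P%:R * w j / D = w j / eps.
    by rewrite /eps invf_div mulrCA mulrA.
  rewrite ler_pdivlMr //; apply: le_trans (ltW cost_x).
  apply: le_trans (sum_event_seq_le x.1.2 (fun t => d_ge0 (path x t) (path x t.+1)) evl).
  rewrite -sum1_count natr_sum mulr_suml.
  rewrite big_mkcond [leRHS]big_mkcond /=; apply: ler_sum => y _.
  rewrite /bad; case: (y.2 <= x.1.2)%N => //=; case: ltP => [|_]; last exact: sumr_ge0.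
  by rewrite mul1r => /ltW.
have [t1 [t1l sz1 good]] := greedy_independent few_bad.
have {}sz1 : (P <= size t1)%N.
  by rewrite -(leq_pmul2l (ltn0Sn (Num.truncn (2 * k%:R * P%:R * w j / D)))) (leq_trans sz_l).
pose cs := [seq i : 'I_k <- enum 'I_k | (j <= i)%N].
have sz_cs : (size cs <= k - j)%N.
  rewrite size_filter -(count_map val (leq j)) val_enum_ord.
  rewrite -[X in iota 0 X](subnKC (ltnW (ltn_ord j))) iotaD count_cat add0n.
  rewrite (eq_in_count (a2 := pred0)) ?count_pred0; last first.
    by move=> i; rewrite mem_iota /= add0n => ij; rewrite leqNgt ij.
  by rewrite (leq_trans (count_size _ _)) ?size_iota.
(* One square root for each of the at most [k - j] heavy servers lowers the exponent from [2 ^ k] to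
   [2 ^ j]. *)
have [|t2 [t2t1 sz2 cod]] := constant_or_distinct_seq
    (fun (i : 'I_k) (e : ev) => e.1.1 i)
    (cs := cs) (n := (k + 2) ^ (2 ^ j)) (s := t1).
  apply: leq_trans sz1; rewrite -expnM -expnD leq_pexp2l ?addn2 //.
  rewrite leq_pexp2l // (leq_trans (leq_add (leqnn j) sz_cs)) // subnKC //.
  exact: ltnW.
have t2l : subseq t2 l by apply: subseq_trans t1l.
have := subseq_pairwise t2l (event_seq_pairwise evl).
have := subseq_pairwise t2t1 good.
case: t2 => [|e0 pet] in sz2 cod t2l {t2t1} *.
  by move: sz2; rewrite leqn0 expn_eq0 addn2.
rewrite /= => /andP[/allP good0 _] /andP[/allP after0 _].
have e0l : e0 \in l by apply: mem_subseq t2l _ (mem_head _ _).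
have [Te0 e0e0 _ De0] := event_seq_mem evl e0l.
(* The consensus needs this size when [a = k - j] members may miss a request. The base [k + 2] of
   the selection leaves room for setting [e0] aside. *)
pose N := (k.+1 ^ (2 ^ j))%N.
have N_le_P : (N <= P)%N.
  apply: (@leq_trans (k.+1 ^ (2 ^ k))); last by rewrite leq_exp2r ?expn_gt0 // addn2.
  by rewrite leq_pexp2l // leq_pexp2l // ltnW.
have sz_pet : (N <= size pet)%N.
  by rewrite -ltnS (leq_trans _ sz2) // ltn_exp2r ?expn_gt0 // addn2.
pose pet0 := take N pet.
have sz_pet0 : size pet0 = N by rewrite size_takel.
have pet0_pet : subseq pet0 pet by apply: take_subseq.
have pet0P e : e \in pet0 -> [/\ e \in l, (e0.2 <= e.1.2)%N & chunk e e0 <= eps].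
  move=> /(mem_subseq pet0_pet) ep; have := good0 e ep; have := after0 e ep => /= ae.
  rewrite /bad ae /= -leNgt; split=> //.
  by apply: (mem_subseq t2l); rewrite inE ep orbT.
have [F [F_serves F_dist]] := light_consensus w_gt0 w_mono
  (ev : eqType) e0.1.1 (k - j) (ltnW (ltn_ord j)).
pose lam t : config k U :=
  [ffun i : 'I_k => if (i < j)%N then F pet0 (path^~ t) i else e0.1.1 i].
have lam_serves t : (e0.1.2 <= t < e0.2)%N -> serves (sigma t) (lam t).
  move=> /andP[e0t te0].
  have [/existsP[i /andP[ij ei]]|no_heavy] :=
      boolP [exists i : 'I_k, (j <= i)%N && (e0.1.1 i == sigma t)].
    by apply/existsP; exists i; rewrite ffunE ltnNge ij.
  suff /existsP[i /andP[ij Fi]] : light_serves j (sigma t) (F pet0 (path^~ t)).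
    by apply/existsP; exists i; rewrite ffunE ij.
  apply: F_serves; first by rewrite sz_pet0 subnK // ltnW.
  (* A member without a light server at the request has a heavy one there. A heavy server of
     constant position stands where [e0] has it, hence not at the request; any other one is there in
     at most one member. So at most [k - j] members miss. *)
  apply: (@leq_trans (count (fun e : ev => has (fun i => e.1.1 i == sigma t) cs) pet0)).
    apply: sub_in_count => e ep miss; have [el e0e _] := pet0P e ep.
    have [Te _ _ _] := event_seq_mem evl el; have [pe re _] := pathP e Te.
    have : (T <= t < e.1.2)%N.
      by rewrite (leq_trans Te0 e0t) (leq_trans te0).
    move=> te; have /existsP[i ei] := re t te.
    have ij : (j <= i)%N.
      rewrite leqNgt; apply/negP => ij; move/negP: miss; apply.
      by apply/existsP; exists i; rewrite ij.
    apply/hasP; exists i; first by rewrite mem_filter mem_enum ij.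
    have cheap_e : path_cost (path e) T e.1.2 < w j by rewrite ltNge cheap.
    rewrite -pe -(path_static cheap_e (t := t) ij) //.
    by case/andP: te => -> /ltnW.
  apply: leq_trans sz_cs; apply: count_has_le => i ics.
  have ij : (j <= i)%N by move: ics; rewrite mem_filter => /andP[].
  have [[u eu]|distinct] := cod i ics; last first.
    apply: leq_trans (distinct (sigma t)).
    exact: leq_count_subseq (subseq_trans pet0_pet (subseq_cons _ _)).
  rewrite (eq_in_count (a2 := pred0)) ?count_pred0 // => e /(mem_subseq pet0_pet) ep.
  apply/negP => ei; move/negP: no_heavy; apply; apply/existsP; exists i.
  by rewrite ij (eu e0) ?mem_head // -(eu e) // inE ep orbT.
have lam_dist t : d (lam t) (lam t.+1) <=
    k%:R * \sum_(e <- pet0) d (path e t) (path e t.+1).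
  apply: (@le_trans _ _ (ld j (F pet0 (path^~ t)) (F pet0 (path^~ t.+1)))).
    rewrite /config_dist /light_dist big_mkcond [leRHS]big_mkcond /=.
    apply: ler_sum => i _; rewrite !ffunE; case: ltnP => //= _; by rewrite eqxx.
  apply: le_trans (F_dist _ _ _) _; rewrite ler_wpM2l ?ler0n //.
  by apply: ler_sum => e _; apply: light_dist_le.
have lam_cost : path_cost lam e0.1.2 e0.2 <= D / 2.
  apply: (@le_trans _ _ (\sum_(e0.1.2 <= t < e0.2)
      k%:R * \sum_(e <- pet0) d (path e t) (path e t.+1))); first exact: ler_sum.
  rewrite -mulr_sumr exchange_big /=.
  apply: (@le_trans _ _ (k%:R * (N%:R * eps))).
    rewrite ler_wpM2l ?ler0n // -sz_pet0 -sum1_size natr_sum mulr_suml.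
    rewrite [leLHS]big_seq [leRHS]big_seq; apply: ler_sum => e /pet0P[_ _].
    by rewrite mul1r.
  have -> : D / 2 = k%:R * (P%:R * eps).
    by rewrite /eps; field; rewrite !gt_eqF.
  by rewrite ler_wpM2l ?ler0n // ler_wpM2r ?(ltW eps_gt0) // ler_nat.
have lam_end t : d e0.1.1 (lam t) <= D / 8.
  apply: (@le_trans _ _ (ld j e0.1.1 (lam t))).
    rewrite /config_dist /light_dist big_mkcond [leRHS]big_mkcond /=.
    apply: ler_sum => i _; rewrite !ffunE; case: ltnP => //= _; by rewrite eqxx.
  apply: le_trans (light_dist_le_weight (x := D / (8 * k%:R)) _ _ _ _) _.
  - move=> i ij; rewrite ler_pdivlMr ?mulr_gt0 // mulrC; exact: light.
  - by rewrite divr_ge0 ?mulr_ge0 ?ltW.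
  by rewrite le_eqVlt; apply/orP; left; apply/eqP; field; rewrite gt_eqF.
(* Joining [lam] at the start, following it and leaving it at the end costs at most
   [D / 8 + D / 2 + D / 8 < D], whereas the event [e0] makes [V] grow by at least [D] at its own
   configuration. *)
have := De0 e0.1.1; rewrite config_distxx.
have := V_lip e0.2 (lam e0.2) e0.1.1; rewrite config_distC.
have := V_lip e0.1.2 e0.1.1 (lam e0.1.2).
have := lam_end e0.1.2; have := lam_end e0.2.
have := path_cost_ub e0e0 lam_serves; lra.
Qed.

(** * Counting events scale by scale *)

Definition few_events (D : R) (a b m : nat) : Prop :=
  forall l, event_seq D a b l -> (size l < m)%N.

(** Cut a long list into [m] consecutive blocks. Each block yields one larger event inside its own
    time span, so the new events are again disjoint. *)
Lemma few_events_step D a b (j : 'I_k) m (P := ((k + 2) ^ (2 ^ k))%N) :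
  0 < D -> (forall i : 'I_k, (i < j)%N -> 8 * k%:R * w i <= D) ->
  few_events (D + w j / 2) a b m ->
  few_events D a b (m * ((Num.truncn (2 * k%:R * P%:R * w j / D)).+1 * P)).
Proof.
move=> D_gt0 light few l evl; rewrite ltnNge; apply/negP.
set q := (_.+1 * P)%N => sz_l.
suff [l' evl' sz_l'] : exists2 l', event_seq (D + w j / 2) a b l' & size l' = m.
  by have := few l' evl'; rewrite sz_l' ltnn.
elim: m a l evl sz_l {few} => [|m IHm] a l evl sz_l.
  by exists [::] => //; apply: event_seq_le evl.
move: evl; rewrite -(cat_take_drop q l) => /event_seq_catl[c evq evd].
have sz_q : size (take q l) = q.
  by rewrite size_takel // (leq_trans _ sz_l) // mulSn leq_addr.
have [|e eq [X evX]] := many_events_gain D_gt0 light evq; first by rewrite sz_q.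
have [ae ee ec _] := event_seq_mem evq eq.
have [|l' evl' sz_l'] := IHm c (drop q l) evd.
  by rewrite size_drop leq_subRL ?(leq_trans _ sz_l) // mulSn ?leq_addr.
exists ((X, a, e.2) :: l'); last by rewrite /= sz_l'.
split=> //=; first exact: leq_trans ee.
exact: (event_seq_cat (l1 := [::])) evl'.
Qed.

(** Bounding the product [m * D] makes the loss independent of the weights: the count loses a factor
    of order [w j / D + 1], and [D] times this is of the order of the new size [D + w j / 2]. *)
Lemma few_events_weaken D a b (j : 'I_k) (x : R) (P := ((k + 2) ^ (2 ^ k))%N) :
  0 < D -> (forall i : 'I_k, (i < j)%N -> 8 * k%:R * w i <= D) ->
  (exists2 m, few_events (D + w j / 2) a b m & m%:R * (D + w j / 2) <= x) ->
  exists2 m, few_events D a b m & m%:R * D <= 5 * k%:R * P%:R ^+ 2 * x.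
Proof.
move=> D_gt0 light [m few mx]; exists (m * ((Num.truncn (2 * k%:R * P%:R * w j / D)).+1 * P))%N.
  exact: few_events_step.
have k_ge1 : 1 <= k%:R :> R by rewrite ler1n; apply: leq_ltn_trans (ltn_ord j).
have P_ge1 : 1 <= P%:R :> R by rewrite ler1n expn_gt0 addn2.
have wj := w_gt0 j; set D' := D + w j / 2 in mx.
have DD' : D' = D + w j / 2 by [].
have m_ge0 : 0 <= m%:R :> R by [].
have tr : (Num.truncn (2 * k%:R * P%:R * w j / D)).+1%:R * D <= 5 * k%:R * P%:R * D'.
  apply: (@le_trans _ _ ((2 * k%:R * P%:R * w j / D + 1) * D)).
    rewrite ler_wpM2r ?(ltW D_gt0) //; set n := Num.truncn _.
    have -> : n.+1%:R = n%:R + 1 :> R by rewrite natr1.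
    rewrite lerD2r truncn_le; apply: divr_ge0; last exact: ltW.
    by rewrite !mulr_ge0 // ltW.
  rewrite mulrDl mul1r divfK ?gt_eqF // DD'.
  have kP : 1 <= k%:R * P%:R :> R by apply: mulr_ege1.
  rewrite -!(mulrA _ k%:R); move: (k%:R * P%:R) kP => z z1.
  have : D <= z * D by rewrite ler_peMl // ltW.
  have : 0 <= z * w j by rewrite mulr_ge0 ?(le_trans _ z1) // ltW.
  lra.
set n := (_.+1)%N in tr *; rewrite !natrM.
rewrite (_ : _ * D = m%:R * P%:R * (n%:R * D)); last by ring.
apply: (@le_trans _ _ (m%:R * P%:R * (5 * k%:R * P%:R * D'))).
  by apply: ler_wpM2l => //; apply: mulr_ge0.
rewrite (_ : _ * (5 * _ * _ * _) = 5 * k%:R * P%:R ^+ 2 * (m%:R * D')); last by ring.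
by apply: ler_wpM2l => //; rewrite !mulr_ge0 // sqr_ge0.
Qed.

Definition scale_loss : R := 5 * k%:R * ((k + 2) ^ (2 ^ k))%:R ^+ 2.

Lemma few_events_iter D a b (j : 'I_k) n (x : R) :
  0 < D -> (forall i : 'I_k, (i < j)%N -> 8 * k%:R * w i <= D) ->
  (exists2 m, few_events (D + n%:R * (w j / 2)) a b m &
              m%:R * (D + n%:R * (w j / 2)) <= x) ->
  exists2 m, few_events D a b m & m%:R * D <= scale_loss ^+ n * x.
Proof.
elim: n D => [|n IHn] D D_gt0 light; first by rewrite !mul0r addr0 expr0 mul1r.
rewrite -natr1 mulrDl mul1r [_ + w j / 2]addrC addrA => few.
have DD' : D <= D + w j / 2 by rewrite lerDl divr_ge0 // ltW.
rewrite exprS -mulrA; apply: (few_events_weaken D_gt0 light).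
apply: IHn => // [|i /light]; first exact: lt_le_trans DD'.
by move/le_trans; apply.
Qed.

(** Induction on [k - j]. After [16 * k] steps the size has grown by [8 * k * w j], so server [j] is
    light too. Once all servers are light, [none] leaves no event at all. *)
Lemma few_events_scales D a b j (top : 'I_k) :
  (forall i, w i <= w top) ->
  (forall D', 8 * k%:R * w top <= D' -> few_events D' a b 1) ->
  0 < D -> (forall i : 'I_k, (i < j)%N -> 8 * k%:R * w i <= D) -> (j <= k)%N ->
  exists2 m, few_events D a b m & m%:R * D <=
    scale_loss ^+ (16 * k * (k - j)) * (D + 8 * k%:R * (k - j)%:R * w top).
Proof.
move=> w_top none; have k_gt0 : (0 < k)%N by apply: leq_ltn_trans (ltn_ord top).
have [r] := ubnP (k - j); elim: r j D => // r IHr j D ltr D_gt0 light.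
rewrite leq_eqVlt => /orP[/eqP jk|lt_jk].
  exists 1%N; last by rewrite jk subnn muln0 expr0 !mul1r mulr0 mul0r addr0.
  by apply: none; apply: light; rewrite jk.
pose jo := Ordinal lt_jk; have wj := w_gt0 jo.
have kj : (k - j = (k - j.+1).+1)%N by rewrite subnSK.
rewrite kj mulnSr addnC exprD -mulrA.
apply: (few_events_iter (j := jo)) => //.
have D' : (16 * k)%:R * (w jo / 2) = 8 * k%:R * w jo by rewrite natrM; field.
rewrite D'; set E := D + _; have DE : D <= E by rewrite lerDl !mulr_ge0 // ltW.
have [||i|//|m few mx] := IHr j.+1 E.
- by rewrite -ltnS -kj.
- exact: lt_le_trans DE.
- rewrite ltnS leq_eqVlt => /orP[/eqP ij|/light/le_trans]; last exact.
  have -> : i = jo by apply: val_inj.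
  by rewrite lerDr ltW.
exists m => //; apply: le_trans mx _; apply: ler_wpM2l.
  by rewrite exprn_ge0 // /scale_loss !mulr_ge0 // sqr_ge0.
rewrite /E -addrA lerD2l -natr1.
have := ler_wpM2l (_ : 0 <= 8 * k%:R :> R) (w_top jo).
by rewrite mulr_ge0 // => /(_ isT); lra.
Qed.

Lemma config_dist_le_weight (x : R) C X :
  (forall i, w i <= x) -> 0 <= x -> d C X <= k%:R * x.
Proof.
move=> wx x_ge0; rewrite /config_dist big_mkcond /=.
apply: (@le_trans _ _ (\sum_(i < k) x)).
  by apply: ler_sum => i _; case: ifP.
by rewrite sumr_const card_ord mulr_natl.
Qed.

(** The event and its endpoint bounds give [D <= 3 * w top + k * w top / 2], which is less than
    [8 * k * w top]. *)
Lemma no_big_event a b (top : 'I_k) mu X D :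
  (forall i, w i <= w top) -> (forall Y, mu <= V a Y) ->
  V b X <= mu + 3 * w top -> 8 * k%:R * w top <= D -> few_events D a b 1.
Proof.
move=> w_top mu_le VbX bigD [|e l] // evl; exfalso.
have [ae ee eb De] := event_seq_mem evl (mem_head _ _).
have k_ge1 : 1 <= k%:R :> R by rewrite ler1n; apply: leq_ltn_trans (ltn_ord top).
have := De X; have := V_homo X eb; have := V_homo e.1.1 ae; have := mu_le e.1.1.
have := config_dist_le_weight X e.1.1 w_top (ltW (w_gt0 top)).
have := ler_wpM2r (ltW (w_gt0 top)) k_ge1; have := w_gt0 top; lra.
Qed.

(** * The cost of the algorithm in terms of events and of the work function *)

Variables (bot top : 'I_k).
Hypothesis w_bot : forall i, w bot <= w i.
Hypothesis w_top : forall i, w i <= w top.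

Variable c : nat -> config k U.
Hypothesis c_start : forall X, V 0 (c 0) <= V 0 X.
Hypothesis c_rule : forall t X,
  V t.+1 (c t.+1) + 1 / 2 * d (c t.+1) (c t) <= V t.+1 X + 1 / 2 * d X (c t).

Let k_gt0 : (0 < k)%N. Proof. exact: leq_ltn_trans (ltn_ord top). Qed.
Let k_ge1 : 1 <= k%:R :> R. Proof. by rewrite ler1n. Qed.

(** The lightest server visits the request and returns. *)
Lemma V_succ_le t C : V t.+1 C <= V t C + 2 * w bot.
Proof.
pose X : config k U := [ffun i => if i == bot then sigma t else C i].
have rX : serves (sigma t) X by apply/existsP; exists bot; rewrite ffunE eqxx.
have dX : d X C <= w bot.
  rewrite /config_dist big_mkcond (bigD1 bot) //= big1 ?addr0 => [|i /negPf ib].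
    by case: ifP => // _; apply: ltW.
  by rewrite ffunE ib eqxx.
have := V_step C rX; have := V_lip t C X.
by rewrite (config_distC w C X); lra.
Qed.

Lemma c_tight t X : V t (c t) <= V t X + 1 / 2 * d X (c t).
Proof.
case: t => [|t]; first by have := c_start X; have := d_ge0 X (c 0); lra.
have := c_rule t X; have := config_dist_triangle w_gt0 (c t.+1) X (c t); lra.
Qed.

(** Amortization with [V y' (c y)] as potential. Here [y'] is the time from which the next event of
    the current configuration is measured; it is reset when an event is recorded or the algorithm
    moves. *)
Lemma algorithm_events a y : (a <= y)%N -> exists l y',
  [/\ event_seq (w bot / 8) a y' l, (y' <= y)%N,
      V y (c y) <= V y' (c y) + w bot / 8
    & 3 / 8 * path_cost c a y + V y' (c y) <=
        3 * w bot * (size l)%:R + V a (c a)].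
Proof.
have wb := w_gt0 bot; elim: y => [|y IHy].
  rewrite leqn0 => /eqP->; exists [::], 0%N; split=> //; first by lra.
  by rewrite /path_cost big_geq //=; lra.
rewrite leq_eqVlt => /orP[/eqP->|].
  exists [::], y.+1; split=> //=; first by lra.
  by rewrite /path_cost big_geq //=; lra.
rewrite ltnS => ay; have [l [y' [evl y'y res cost]]] := IHy ay.
have rule := c_rule y; have self := rule (c y); rewrite config_distxx in self.
have succ := V_succ_le y (c y).
have pc : path_cost c a y.+1 = path_cost c a y + d (c y.+1) (c y).
  by rewrite /path_cost big_nat_recr //= (config_distC w (c y)).
have dd := d_ge0 (c y.+1) (c y); move: rule self pc dd.
set dy := d (c y.+1) (c y) => rule self pc dd.
(* If the objective has risen by [w bot / 8] since [y'], an event is recorded. The potential then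
   rises by at most [w bot / 8 + 2 * w bot], within the [3 * w bot] paid for it. *)
have [big|small] := lerP (V y' (c y) + w bot / 8) (V y.+1 (c y.+1) + 1 / 2 * dy).
  exists (rcons l (c y, y', y.+1)), y.+1; split=> //; last 2 first.
  - lra.
  - have -> : (size (rcons l (c y, y', y.+1)))%:R = (size l)%:R + 1 :> R.
      by rewrite size_rcons natr1.
    by rewrite pc; lra.
  rewrite -cats1; apply: event_seq_cat evl _; split=> //=; first exact: leqW.
  by move=> X /=; have := rule X; lra.
have [stay|move_c] := eqVneq (c y.+1) (c y).
  exists l, y'; rewrite stay pc; split=> //; first exact: leqW.
    by move: small; rewrite stay; lra.
  by move: cost; rewrite /dy stay config_distxx; lra.
(* An actual move costs [dy >= w bot], so without an event the potential drops by at least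
   [dy / 2 - dy / 8]; this is the coefficient [3 / 8]. *)
have dy_ge : w bot <= dy.
  have [i ci] : exists i, c y.+1 i != c y i.
    apply/existsP; rewrite -negb_forall; apply: contra move_c => /forallP eqc.
    by apply/eqP/ffunP => i; apply/eqP.
  exact: le_trans (w_bot i) (weight_le_config_dist w_gt0 ci).
exists l, y.+1; split=> //; last 2 first.
- lra.
- by rewrite pc; lra.
by rewrite -[l]cats0; apply: event_seq_cat evl _ => /=; apply: leqW.
Qed.

(** The exponent counts the scale steps from size [w bot / 8] with [j = 0]. Events contribute
    [3 * 72] and the initial gap at most [1 / 2], in units of the remaining factor times [w top];
    dividing by [3 / 8] gives less than [578]. *)
Definition rate : R := 578 * k%:R ^+ 2 * scale_loss ^+ (16 * k * k).

Lemma scale_loss_ge1 : 1 <= scale_loss.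
Proof.
have P_ge1 : 1 <= ((k + 2) ^ (2 ^ k))%:R :> R by rewrite ler1n expn_gt0 addn2.
by rewrite /scale_loss !mulr_ege1 // ?exprn_ege1 // ler1n.
Qed.

Lemma phase_cost a b mu X : (a <= b)%N -> (forall Y, mu <= V a Y) ->
  V b X <= mu + 3 * w top -> (exists Y, V a Y = mu) ->
  path_cost c a b <= rate * w top.
Proof.
move=> ab mu_le VbX [Y VaY]; have [l [y' [evl y'b _ cost]]] := algorithm_events ab.
have wb := w_gt0 bot; have wt := w_gt0 top; have wbt := w_top bot.
have [||//|//|m few mx] := @few_events_scales (w bot / 8) a b 0 top w_top.
- by move=> D'; apply: no_big_event mu_le VbX.
- by rewrite divr_gt0.
rewrite subn0 in mx; have evlb : event_seq (w bot / 8) a b l.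
  by rewrite -[l]cats0; apply: event_seq_cat evl _.
have sz : (size l)%:R <= m%:R :> R by rewrite ler_nat ltnW // few.
set C := scale_loss ^+ _ in mx; have C_ge1 : 1 <= C by rewrite exprn_ege1 ?scale_loss_ge1.
have tight := c_tight a Y; have low := mu_le (c b); have mono := V_homo (c b) (event_seq_le evl).
have dist := config_dist_le_weight Y (c a) w_top (ltW wt).
have sw : (size l)%:R * w bot <= m%:R * w bot by rewrite ler_wpM2r // ltW.
rewrite /rate -/C.
have kk : k%:R <= k%:R ^+ 2 :> R by rewrite expr2 ler_peMl // ler0n.
have k2_ge1 : 1 <= k%:R ^+ 2 :> R by rewrite exprn_ege1.
have mC : m%:R * w bot <= 72 * (C * (k%:R ^+ 2 * w top)).
  have b1 : w bot / 8 + 8 * k%:R * k%:R * w top <= 9 * (k%:R ^+ 2 * w top).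
    have : w top <= k%:R ^+ 2 * w top by rewrite ler_peMl // ltW.
    by rewrite -mulrA -mulrA -(mulrA k%:R) mulrA -expr2; lra.
  have := ler_wpM2l (le_trans ler01 C_ge1) b1; lra.
have k2C : k%:R * w top <= C * (k%:R ^+ 2 * w top).
  apply: (@le_trans _ _ (k%:R ^+ 2 * w top)); first by rewrite ler_wpM2r // ltW.
  by rewrite ler_peMl // mulr_ge0 // ?sqr_ge0 // ltW.
rewrite (_ : 578 * _ * C * w top = 578 * (C * (k%:R ^+ 2 * w top))); last by ring.
have : 0 <= k%:R * w top by rewrite mulr_ge0 // ltW.
lra.
Qed.

(** Time is cut into phases, each ending once the minimum [M] of [V] has risen by more than [w top].
    As one request raises [M] by at most [2 * w bot], a phase raises it by at most [3 * w top].
    Finished phases are charged to the growth of [M], the last one to the additive term. *)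
Lemma algorithm_cost_le n X :
  path_cost c 0 n <= rate * (V n X - V 0 (c 0)) + rate * w top.
Proof.
have wb := w_gt0 bot; have wt := w_gt0 top; have wbt := w_top bot.
have rate_ge0 : 0 <= rate.
  by rewrite !mulr_ge0 ?sqr_ge0 ?exprn_ge0 // (le_trans ler01) ?scale_loss_ge1.
have /choice[x xP] : forall t, exists Z, forall Y, V t Z <= V t Y.
  move=> t; exists [arg min_(Z < c 0) V t Z]%O.
  by case: arg_minP => // Z _ Zmin Y; apply: Zmin.
pose M t := V t (x t).
have M0 : M 0%N = V 0 (c 0) by apply/eqP; rewrite eq_le xP c_start.
have Mmono s t : (s <= t)%N -> M s <= M t.
  by move=> st; apply: le_trans (xP s (x t)) (V_homo _ st).
have Msucc t : M t.+1 <= M t + 2 * w bot.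
  by apply: le_trans (xP t.+1 (x t)) (V_succ_le _ _).
have phase a b : (a <= b)%N -> M b <= M a + 3 * w top -> path_cost c a b <= rate * w top.
  by move=> ab Mb; apply: (phase_cost ab (xP a) Mb); exists (x a).
have [a [an Mn cost]] : exists a, [/\ (a <= n)%N, M n <= M a + w top
    & path_cost c 0 a <= rate * (M a - M 0%N)].
  elim: n => [|n [a [an Mn cost]]].
    by exists 0%N; split=> //; [lra|rewrite /path_cost big_geq // subrr mulr0].
  have [keep|new] := lerP (M n.+1) (M a + w top); first by exists a; split=> //; apply: leqW.
  exists n.+1; split=> //; first lra.
  have -> : path_cost c 0 n.+1 = path_cost c 0 a + path_cost c a n.+1.
    by rewrite /path_cost -big_cat_nat //= leqW.
  apply: le_trans (lerD cost (phase a n.+1 (leqW an) _)) _.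
    by have := Msucc n; lra.
  by rewrite -mulrDr ler_wpM2l //; lra.
have -> : path_cost c 0 n = path_cost c 0 a + path_cost c a n.
  by rewrite /path_cost -big_cat_nat.
apply: lerD; last by apply: phase => //; lra.
apply: le_trans cost _; rewrite -M0 ler_wpM2l // lerD2r.
exact: le_trans (Mmono _ _ an) (xP n X).
Qed.

End Events.

(** * The work function of a request sequence and the algorithm it defines *)

Section WorkFunction.
Context {R : realType} {k : nat} {U : finType}.
Variable w : 'I_k -> R.
Hypothesis w_gt0 : forall i, 0 < w i.
Hypothesis k_gt0 : (0 < k)%N.
Variable C0 : config k U.
Local Notation d := (@config_dist R k U w).
Local Notation wf := (work_function w C0).

Lemma all2_rcons (S T : Type) (r : S -> T -> bool) s t x y :
  all2 r (rcons s x) (rcons t y) = all2 r s t && r x y.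
Proof.
elim: s t => [|a s IHs] [|b t] //=; rewrite ?andbT ?IHs ?andbA //.
- by case: t => [|? ?] /=; rewrite andbF.
- by case: s {IHs} => [|? ?] /=; rewrite andbF.
Qed.

(** Feasibility fixes the length, so the minimum runs over a finite type of tuples; putting all
    servers on each request gives a feasible one. *)
Lemma feasible_argmin (s : seq U) (f : seq (config k U) -> R) :
  exists2 X, feasible s X & forall Y, feasible s Y -> f X <= f Y.
Proof.
pose X0 := [seq ([ffun=> r] : config k U) | r <- s].
have feasX0 : feasible s X0.
  rewrite /X0; elim: s {X0 f} => //= r s ->; rewrite andbT.
  by apply/existsP; exists (Ordinal k_gt0); rewrite ffunE.
have szX0 : size X0 == size s by rewrite size_map.
pose t0 : (size s).-tuple (config k U) := Tuple szX0.
have [t feas_t t_min] := @arg_minP _ _ _ t0 (fun t : (size s).-tuple _ => feasible s t) (fun t => f t) feasX0.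
exists (val t) => // Y feasY.
have szY : size Y == size s by move: feasY; rewrite /feasible all2E eq_sym => /andP[].
exact: (t_min (Tuple szY)).
Qed.

Lemma inf_feasible (s : seq U) (f : seq (config k U) -> R) :
  exists X, [/\ feasible s X, inf [set f X | X in [set X | feasible s X]] = f X
    & forall Y, feasible s Y -> f X <= f Y].
Proof.
have [X feasX Xmin] := feasible_argmin s f; exists X; split=> //.
have lb : lbound [set f X | X in [set X | feasible s X]] (f X).
  by move=> _ [Y feasY <-]; apply: Xmin.
apply/eqP; rewrite eq_le; apply/andP; split.
  by apply: ge_inf; [exists (f X) | exists X].
by apply: lb_le_inf => //; exists (f X), X.
Qed.

Lemma movement_cost_rcons C X Y :
  movement_cost w C (rcons X Y) = movement_cost w C X + d (last C X) Y.
Proof. by elim: X C => [|Z X IHX] C /=; rewrite ?addr0 ?add0r // IHX addrA. Qed.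

Lemma work_function_attained s C : exists X, [/\ feasible s X,
    wf s C = movement_cost w C0 (rcons X C)
  & forall Y, feasible s Y -> wf s C <= movement_cost w C0 (rcons Y C)].
Proof.
have [X [feasX wfX Xmin]] :=
  inf_feasible s (fun X => movement_cost w C0 (rcons X C)).
by exists X; split=> // Y feasY; rewrite /work_function wfX; apply: Xmin.
Qed.

Lemma work_function0 C : wf [::] C = d C0 C.
Proof.
by have [[|Y X] [// _ -> _]] := work_function_attained [::] C; rewrite /= addr0.
Qed.

Lemma work_function_step s r X C :
  serves r X -> wf (rcons s r) C <= wf s X + d X C.
Proof.
move=> rX; have [Y [feasY -> _]] := work_function_attained s X.
have [_ [_ _ wf_le]] := work_function_attained (rcons s r) C.
have := wf_le (rcons Y X); rewrite /feasible all2_rcons rX andbT => /(_ feasY).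
by rewrite [X in _ <= X]movement_cost_rcons last_rcons.
Qed.

Lemma work_function_opt s r C :
  exists2 X, serves r X & wf (rcons s r) C = wf s X + d X C.
Proof.
have [Z [feasZ wfZ _]] := work_function_attained (rcons s r) C.
case/lastP: Z => [|Y X] in feasZ wfZ; first by case: s feasZ {wfZ}.
move: feasZ; rewrite /feasible all2_rcons => /andP[feasY rX].
exists X => //; apply/eqP; rewrite eq_le work_function_step //=.
rewrite wfZ movement_cost_rcons last_rcons lerD2r.
by have [_ [_ _]] := work_function_attained s X; apply.
Qed.

Lemma work_function_le_opt s : exists X, wf s X <= opt_cost w C0 s.
Proof.
have [Z [feasZ optZ _]] := inf_feasible s (movement_cost w C0).
exists (last C0 Z); rewrite /opt_cost optZ.
have [_ [_ _ wf_le]] := work_function_attained s (last C0 Z).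
by apply: le_trans (wf_le Z feasZ) _; rewrite movement_cost_rcons config_distxx addr0.
Qed.

Lemma opt_cost_ge0 s : 0 <= opt_cost w C0 s.
Proof.
have [Z [_ optZ _]] := inf_feasible s (movement_cost w C0).
rewrite /opt_cost optZ; elim: Z {optZ} (C0) => //= C Z IHZ C1.
by rewrite addr_ge0 // config_dist_ge0.
Qed.

Lemma movement_cost_path (c : nat -> config k U) a n :
  movement_cost w (c a) [seq c t | t <- iota a.+1 n] = path_cost w c a (a + n).
Proof.
elim: n a => [|n IHn] a /=; first by rewrite addn0 /path_cost big_geq.
by rewrite IHn addSnnS /path_cost [in RHS]big_ltn // addnS ltnS leq_addr.
Qed.

Variable A : algorithm k U.
Hypothesis A_wfa : is_WFA w (1 / 2) C0 A.

(** Let [X] be the configuration serving [r] on an optimal way to the chosen one. Comparing the two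
    in the rule bounds their distance by half of itself, so they coincide. *)
Lemma WFA_online : online_algorithm C0 A.
Proof.
case: A_wfa => A0 rule; split=> // s r.
have [X rX wfX] := work_function_opt s r (A (rcons s r)).
have := rule s r X; have := work_function_step s X rX; rewrite config_distxx.
have := config_dist_triangle w_gt0 (A (rcons s r)) X (A s) => tri stepX ruleX.
by rewrite -(@config_dist_le0 _ _ _ _ w_gt0 X (A (rcons s r))) //; lra.
Qed.

End WorkFunction.

Lemma WFA_cost (R : realType) (n : nat) (U : finType) (w : 'I_n.+1 -> R)
    (C0 : config n.+1 U) (A : algorithm n.+1 U) (s : seq U) :
  (forall i, 0 < w i) -> (forall i j : 'I_n.+1, (i <= j)%N -> w i <= w j) ->
  is_WFA w (1 / 2) C0 A ->
  algorithm_cost w A s <=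
    @rate R n.+1 * opt_cost w C0 s + @rate R n.+1 * w ord_max.
Proof.
(* The requests are extended past the end of [s] by an arbitrary default; the cost is only taken up
   to time [size s]. *)
move=> w_gt0 w_mono [A0 rule]; pose r := nth (C0 ord0) s.
have k_gt0 := ltn0Sn n.
pose V t := work_function w C0 (mkseq r t); pose c t := A (mkseq r t).
have V0 C : V 0%N C = config_dist w C0 C by rewrite /V work_function0.
have take_r t : (t <= size s)%N -> take t s = mkseq r t.
  by move=> ts; rewrite -{1}(mkseq_nth (C0 ord0) s) -map_take take_iota (minn_idPl ts).
have -> : algorithm_cost w A s = path_cost w c 0 (size s).
  rewrite -[X in path_cost _ _ _ X]add0n -movement_cost_path /algorithm_cost.
  congr (movement_cost w _ _); apply/eq_in_map => t; rewrite mem_iota add1n ltnS.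
  by move=> /andP[_ ts]; rewrite take_r.
have [X wfX] := work_function_le_opt w k_gt0 C0 s.
have Vs : V (size s) X = work_function w C0 s X by rewrite /V mkseq_nth.
have c0 : c 0%N = C0 by [].
have := @algorithm_cost_le _ _ _ w w_gt0 w_mono r V _ _ _ ord0 ord_max _ _ c _ _ (size s) X.
rewrite V0 c0 config_distxx subr0 Vs => cost.
apply: le_trans (cost _ _ _ _ _ _ _) _.
- by move=> Y C; rewrite !V0; apply: config_dist_triangle.
- by move=> t Y C rY; rewrite /V mkseqS; apply: work_function_step.
- by move=> t C; rewrite /V mkseqS; apply: work_function_opt.
- by move=> i; apply: w_mono.
- by move=> i; apply: w_mono; rewrite -ltnS.
- by move=> Y; rewrite V0; apply: config_dist_ge0.
- by move=> t Y; rewrite /V /c mkseqS; apply: rule.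
rewrite lerD2r ler_wpM2l //.
by rewrite /rate /scale_loss !mulr_ge0 ?exprn_ge0 ?mulr_ge0 ?exprn_ge0.
Qed.

(** * Numerical estimates and the theorem *)

(** Since [scale_loss] is at most [2 ^ (6 * k * 2 ^ k)], its power contributes [96 * k ^ 3 * 2 ^ k]
    to the exponent; the slack up to [128] absorbs [578 * k ^ 2]. *)
Lemma rate_le (R : realType) (k : nat) : (0 < k)%N ->
  @rate R k <= 2 ^+ (128 * k ^ 3 * 2 ^ k).
Proof.
move=> k_gt0; pose P := ((k + 2) ^ (2 ^ k))%N.
have -> : @rate R k = (578 * k ^ 2 * (5 * k * P ^ 2) ^ (16 * k * k))%:R.
  by rewrite /rate /scale_loss -/P !natrM !natrX !natrM !natrX.
rewrite -natrX ler_nat.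
have k_le : (k <= 2 ^ k)%N by rewrite ltnW // ltn_expl.
have P_le : (P <= 2 ^ (k.+1 * 2 ^ k))%N.
  rewrite expnM leq_exp2r ?expn_gt0 // expnS.
  by have := ltn_expl k (ltnSn 1); lia.
have C_le : (5 * k * P ^ 2 <= 2 ^ (6 * k * 2 ^ k))%N.
  apply: (@leq_trans (2 ^ 3 * 2 ^ k * (2 ^ (k.+1 * 2 ^ k)) ^ 2)).
    by rewrite leq_mul ?leq_exp2r // leq_mul.
  by rewrite -expnM -!expnD leq_exp2l //; have := ltn_expl k (ltnSn 1); nia.
apply: (@leq_trans (2 ^ 10 * (2 ^ k) ^ 2 * (2 ^ (6 * k * 2 ^ k)) ^ (16 * k * k))).
  by rewrite leq_mul // ?leq_exp2r ?muln_gt0 ?k_gt0 // leq_mul // leq_exp2r.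
rewrite -!expnM -!expnD leq_exp2l //.
have : (1 <= 2 ^ k)%N by rewrite expn_gt0.
move: (2 ^ k)%N k_le => z kz z1; nia.
Qed.

Lemma powR_log_cube (R : realType) (k : nat) : (0 < k)%N ->
  2 `^ (k%:R + (7 + 3 * (ln k%:R / ln 2))) = (128 * k ^ 3 * 2 ^ k)%:R :> R.
Proof.
move=> k_gt0; have ln2 : ln 2 != 0 :> R by rewrite gt_eqF // ln_gt0 // ltr1n.
rewrite /powR gt_eqF // mulrDl mulrDl -mulrA divfK // 2!expRD.
rewrite !expRM_natl !lnK ?posrE ?ltr0n //.
by rewrite !natrM !natrX; ring.
Qed.

Theorem theorem2 (R : realType) :
  exists g : nat -> R,
    g =O_\oo (fun k : nat => ln (k%:R : R)) /\
    forall k : nat, (0 < k)%N ->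
    forall (U : finType) (w : 'I_k -> R) (C0 : config k U) (A : algorithm k U),
      (forall i : 'I_k, 0 < w i) ->
      (forall i j : 'I_k, (i <= j)%N -> w i <= w j) ->
      is_WFA w (1 / 2) C0 A ->
      competitive w C0 A (2 `^ (2 `^ (k%:R + g k))).
Proof.
have ln2 : 0 < ln 2 :> R by rewrite ln_gt0 // ltr1n.
exists (fun k => 7 + 3 * (ln k%:R / ln 2)); split.
  (* For [k >= 2] the ratio [ln k / ln 2] is at least [1], so [7] plus three times it is at most ten
     times it. *)
  apply/eqO_exP; exists (10 / ln 2); first by rewrite divr_gt0.
  near=> k; have k_ge2 : (2 <= k)%N by near: k; apply: nbhs_infty_ge.
  have lnk : ln 2 <= ln k%:R :> R.
    by rewrite ler_ln ?posrE ?ltr0n ?ler_nat // (leq_trans _ k_ge2).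
  have lnk_gt0 := lt_le_trans ln2 lnk; have lnV_gt0 : 0 < (ln 2)^-1 :> R by rewrite invr_gt0.
  rewrite !ger0_norm ?(ltW lnk_gt0) //; last first.
    by rewrite addr_ge0 // mulr_ge0 // divr_ge0 // ltW.
  have : 1 <= ln k%:R / ln 2 :> R by rewrite ler_pdivlMr // mul1r.
  lra.
case=> // n _ U w C0 A w_gt0 w_mono A_wfa; split.
  exact (WFA_online w_gt0 (ltn0Sn n) A_wfa).
exists (@rate R n.+1 * w ord_max) => s.
apply: le_trans (WFA_cost s w_gt0 w_mono A_wfa) _; rewrite lerD2r.
apply: ler_wpM2r; first exact: opt_cost_ge0.
by rewrite powR_log_cube // powR_mulrn // rate_le.
Unshelve. all: by end_near.
Qed.
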